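(* Among the Hopf algebras over $\mathbb{F}_2$ of dimension $n\le3$, only the Grassmann line $\mathbb{F}_2[x]/\langle x^2\rangle$ with $x$ primitive ($\Delta x=x\otimes1+1\otimes x$) admits a nontrivial quasitriangular structure. Its nontrivial quasitriangular structure is $\mathcal{R}=1\otimes1+x\otimes x$, which is triangular.
   Context: A quasitriangular structure on a Hopf algebra $H$ is an invertible $\mathcal{R}\in H\otimes H$ with $(\Delta\otimes\mathrm{id})\mathcal{R}=\mathcal{R}_{13}\mathcal{R}_{23}$, $(\mathrm{id}\otimes\Delta)\mathcal{R}=\mathcal{R}_{13}\mathcal{R}_{12}$ and $\mathcal{R}\,\Delta h=(\Delta^{cop}h)\,\mathcal{R}$ for all $h\in H$, where $\Delta^{cop}$ is $\Delta$ followed by the flip and suffixes denote positions in $H^{\otimes3}$. It is nontrivial if $\mathcal{R}\ne1\otimes1$, and triangular if $\mathcal{R}_{21}\mathcal{R}=1\otimes1$, where $\mathcal{R}_{21}$ is $\mathcal{R}$ with tensor factors flipped. Up to isomorphism, the Hopf algebras of dimension 2 and 3 over $\mathbb{F}_2$ are the Grassmann line, $\mathbb{F}_2\mathbb{Z}_2$, $\mathbb{F}_2(\mathbb{Z}_2)$, $\mathbb{F}_2\mathbb{Z}_3$, $\mathbb{F}_2(\mathbb{Z}_3)$, where $\mathbb{F}_2\Gamma$ is the group algebra and $\mathbb{F}_2(\Gamma)$ the function algebra of $\Gamma$. *)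

(* Defs.v *)
From HB Require Import structures.
From mathcomp Require Import all_boot all_order all_algebra all_field.

Set Implicit Arguments.
Unset Strict Implicit.
Unset Printing Implicit Defensive.

Import GRing.Theory.
Local Open Scope ring_scope.

Reserved Notation "u '\ox' v" (at level 40, left associativity).

(* The tensor product of finite-dimensional vector spaces, in coordinates: the
   (i, j) entry of a tensor is its coefficient on e_i \ox f_j, for the library's
   bases e of U and f of V. *)
Definition tensor (F : fieldType) (U V : vectType F) : Type :=
  'M[F]_(\dim {:U}, \dim {:V}).

HB.instance Definition _ (F : fieldType) (U V : vectType F) :=
  Vector.copy (tensor U V) 'M[F]_(\dim {:U}, \dim {:V}).

Section Tensor.

Variables (F : fieldType) (U V W : vectType F).

Definition pure (u : U) (v : V) : tensor U V :=
  \matrix_(i, j) (coord (vbasis {:U}) i u * coord (vbasis {:V}) j v).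

(* The linear map on U \ox V induced by a bilinear map f; see [tlift_pure]. *)
Definition tlift (f : U -> V -> W) (t : tensor U V) : W :=
  \sum_i \sum_j t i j *: f (vbasis {:U})`_i (vbasis {:V})`_j.

Lemma tlift_is_linear f : linear (tlift f).
Proof.
move=> a s t; rewrite /tlift scaler_sumr -big_split; apply: eq_bigr => i _ /=.
rewrite scaler_sumr -big_split; apply: eq_bigr => j _ /=.
by rewrite !mxE scalerDl scalerA.
Qed.

HB.instance Definition _ f :=
  GRing.isSemilinear.Build F (tensor U V) W _ (tlift f)
    (GRing.semilinear_linear (tlift_is_linear f)).

Lemma tlift_linear_fun (f g h : U -> V -> W) k t :
    (forall u v, f u v = k *: g u v + h u v) ->
  tlift f t = k *: tlift g t + tlift h t.
Proof.
move=> fgh; rewrite /tlift scaler_sumr -big_split; apply: eq_bigr => i _ /=.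
rewrite scaler_sumr -big_split; apply: eq_bigr => j _ /=.
by rewrite fgh scalerDr !scalerA mulrC.
Qed.

Definition is_bilinear (f : U -> V -> W) :=
  (forall v, linear (f^~ v)) /\ (forall u, linear (f u)).

Lemma pureDl a u u' v : pure (a *: u + u') v = a *: pure u v + pure u' v.
Proof. by apply/matrixP=> i j; rewrite !mxE linearP mulrDl mulrA. Qed.

Lemma pureDr a u v v' : pure u (a *: v + v') = a *: pure u v + pure u v'.
Proof. by apply/matrixP=> i j; rewrite !mxE linearP mulrDr mulrCA. Qed.

Lemma pureDl1 u u' v : pure (u + u') v = pure u v + pure u' v.
Proof. by rewrite -[u]scale1r pureDl !scale1r. Qed.

Lemma pureDr1 u v v' : pure u (v + v') = pure u v + pure u v'.
Proof. by rewrite -[v]scale1r pureDr !scale1r. Qed.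

Lemma pure0l v : pure 0 v = 0.
Proof. by apply/matrixP=> i j; rewrite !mxE linear0 mul0r. Qed.

Lemma pure0r u : pure u 0 = 0.
Proof. by apply/matrixP=> i j; rewrite !mxE linear0 mulr0. Qed.

Lemma tlift_pure f u v : is_bilinear f -> tlift f (pure u v) = f u v.
Proof.
case=> fl fr.
pose flL v : {linear U -> W} :=
  HB.pack (f^~ v) (GRing.isSemilinear.Build F U W _ (f^~ v)
    (GRing.semilinear_linear (fl v))).
pose frL u : {linear V -> W} :=
  HB.pack (f u) (GRing.isSemilinear.Build F V W _ (f u)
    (GRing.semilinear_linear (fr u))).
rewrite {2}(coord_vbasis (memvf u)) [RHS](linear_sum (flL v)).
apply: eq_bigr => i _; rewrite [RHS](linearZZ (flL v)) /=.
rewrite {2}(coord_vbasis (memvf v)) [X in _ = _ *: X](linear_sum (frL _)).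
rewrite scaler_sumr; apply: eq_bigr => j _.
by rewrite [X in _ = _ *: X](linearZZ (frL _)) scalerA mxE.
Qed.

End Tensor.

Notation "u '\ox' v" := (pure u v) : ring_scope.

Lemma tensor_sum (F : fieldType) (U V : vectType F) (t : tensor U V) :
  t = \sum_i \sum_j t i j *: ((vbasis {:U})`_i \ox (vbasis {:V})`_j).
Proof.
apply/matrixP=> k l; rewrite !summxE (bigD1 k) //= summxE (bigD1 l) //= !mxE.
have fU := basis_free (vbasisP {:U}); have fV := basis_free (vbasisP {:V}).
rewrite !coord_free // !eqxx !mulr1 [X in _ + X + _]big1 => [|j jl]; last first.
  by rewrite !mxE !coord_free // (negPf jl) !mulr0.
rewrite [X in _ + X]big1 ?addr0 // => i ik; rewrite summxE big1 // => j _.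
by rewrite !mxE !coord_free // (negPf ik) mul0r mulr0.
Qed.

Lemma tensor_ext (F : fieldType) (U V W : vectType F)
    (f g : {linear tensor U V -> W}) :
  (forall u v, f (u \ox v) = g (u \ox v)) -> f =1 g.
Proof.
move=> fg t; rewrite (tensor_sum t) !linear_sum; apply: eq_bigr => i _.
by rewrite !linear_sum; apply: eq_bigr => j _; rewrite !linearZ /= fg.
Qed.

Section TensorAlgebra.

Variables (F : fieldType) (A B : falgType F).
Implicit Types s t : tensor A B.

Definition tensor_mul s t : tensor A B :=
  tlift (fun a b => tlift (fun c d => (a * c) \ox (b * d)) t) s.

Let mul_bilin1 (a : A) (b : B) :
  is_bilinear (fun c d => (a * c) \ox (b * d)).
Proof.
split=> [d|c] k x y; first by rewrite mulrDr -scalerAr pureDl.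
by rewrite mulrDr -scalerAr pureDr.
Qed.

Let mul_linr s : linear (tensor_mul s).
Proof.
by move=> k t t'; apply: tlift_linear_fun => a b; rewrite linearP.
Qed.

Let mul_linl t : linear (tensor_mul^~ t).
Proof. exact: tlift_is_linear. Qed.

Let mulr_ s : {linear tensor A B -> tensor A B} :=
  HB.pack (tensor_mul s) (GRing.isSemilinear.Build F _ _ _ (tensor_mul s)
    (GRing.semilinear_linear (mul_linr s))).
Let mull_ t : {linear tensor A B -> tensor A B} :=
  HB.pack (tensor_mul^~ t) (GRing.isSemilinear.Build F _ _ _ (tensor_mul^~ t)
    (GRing.semilinear_linear (mul_linl t))).

Let mul_pure (a c : A) (b d : B) :
  tensor_mul (a \ox b) (c \ox d) = (a * c) \ox (b * d).
Proof.
have H a' b' : tlift (fun c d => (a' * c) \ox (b' * d)) (c \ox d)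
    = (a' * c) \ox (b' * d) by rewrite tlift_pure.
rewrite /tensor_mul tlift_pure ?H //.
split=> [b'|a'] k x y; rewrite !H mulrDl -scalerAl; first exact: pureDl.
exact: pureDr.
Qed.

Fact tensor_mulA : associative tensor_mul.
Proof.
move=> r s t.
apply: (tensor_ext (f := mull_ (tensor_mul s t)) (g := mull_ t \o mull_ s)) r.
move=> a b; apply: (tensor_ext (f := mulr_ (a \ox b) \o mull_ t)
  (g := mull_ t \o mulr_ (a \ox b))) s.
move=> c d; apply: (tensor_ext (f := mulr_ (a \ox b) \o mulr_ (c \ox d))
  (g := mulr_ (tensor_mul (a \ox b) (c \ox d)))) t.
by move=> e f /=; rewrite !mul_pure !mulrA.
Qed.

Fact tensor_mul1l : left_id (1 \ox 1) tensor_mul.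
Proof.
move=> t; apply: (tensor_ext (f := mulr_ (1 \ox 1)) (g := idfun)) t.
by move=> a b /=; rewrite mul_pure !mul1r.
Qed.

Fact tensor_mul1r : right_id (1 \ox 1) tensor_mul.
Proof.
move=> t; apply: (tensor_ext (f := mull_ (1 \ox 1)) (g := idfun)) t.
by move=> a b /=; rewrite mul_pure !mulr1.
Qed.

Fact tensor_mulDl : left_distributive tensor_mul +%R.
Proof. by move=> r s t; rewrite -[tensor_mul _ t]/(mull_ t _) linearD. Qed.

Fact tensor_mulDr : right_distributive tensor_mul +%R.
Proof. by move=> r s t; rewrite -[tensor_mul r _]/(mulr_ r _) linearD. Qed.

Let coord_neq0 (V : vectType F) (v : V) :
  v != 0 -> exists i, coord (vbasis {:V}) i v != 0.
Proof.
move=> v0; apply/existsP; apply: contraNT v0; rewrite negb_exists.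
move=> /forallP v0; rewrite (coord_vbasis (memvf v)) big1 // => i _.
by have:= v0 i; rewrite negbK => /eqP ->; rewrite scale0r.
Qed.

Fact tensor_1_neq0 : (1 : A) \ox (1 : B) != 0.
Proof.
have [i i0] := coord_neq0 (oner_neq0 A); have [j j0] := coord_neq0 (oner_neq0 B).
apply/eqP=> /matrixP/(_ i j)/eqP; rewrite !mxE mulf_eq0.
by rewrite (negPf i0) (negPf j0).
Qed.

HB.instance Definition _ := GRing.Zmodule_isNzRing.Build (tensor A B)
  tensor_mulA tensor_mul1l tensor_mul1r tensor_mulDl tensor_mulDr tensor_1_neq0.

Fact tensor_scaleAl k s t : k *: (s * t) = (k *: s) * t.
Proof. by rewrite -[LHS](linearZZ (mull_ t)). Qed.

HB.instance Definition _ :=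
  GRing.Lmodule_isLalgebra.Build F (tensor A B) tensor_scaleAl.

Fact tensor_scaleAr k s t : k *: (s * t) = s * (k *: t).
Proof. by rewrite -[LHS](linearZZ (mulr_ s)). Qed.

HB.instance Definition _ :=
  GRing.Lalgebra_isAlgebra.Build F (tensor A B) tensor_scaleAr.

HB.instance Definition _ := Algebra_isFalgebra.Build F (tensor A B).

Lemma pureM (a c : A) (b d : B) : (a \ox b) * (c \ox d) = (a * c) \ox (b * d).
Proof. exact: mul_pure. Qed.

Lemma tensor1E : (1 : tensor A B) = 1 \ox 1.
Proof. by []. Qed.

End TensorAlgebra.

Definition tmap (F : fieldType) (U V U' V' : vectType F)
    (f : U -> U') (g : V -> V') : tensor U V -> tensor U' V' :=
  tlift (fun u v => f u \ox g v).

Definition tswap (F : fieldType) (U V : vectType F) :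
    tensor U V -> tensor V U :=
  tlift (fun u v => v \ox u).

Definition tassoc (F : fieldType) (U V W : vectType F) :
    tensor U (tensor V W) -> tensor (tensor U V) W :=
  tlift (fun u => tlift (fun v w => (u \ox v) \ox w)).

Section TensorMaps.

Variable F : fieldType.

HB.instance Definition _ (U V U' V' : vectType F) (f : U -> U') (g : V -> V') :=
  GRing.Linear.on (tmap f g).

HB.instance Definition _ (U V : vectType F) :=
  GRing.Linear.on (@tswap F U V).

HB.instance Definition _ (U V W : vectType F) :=
  GRing.Linear.on (@tassoc F U V W).

Lemma tmap_pure (U V U' V' : vectType F) (f : {linear U -> U'})
    (g : {linear V -> V'}) u v : tmap f g (u \ox v) = f u \ox g v.
Proof.
by apply: tlift_pure; split=> [y|x] k a b; rewrite linearP ?pureDl ?pureDr.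
Qed.

Lemma tswap_pure (U V : vectType F) (u : U) (v : V) : tswap (u \ox v) = v \ox u.
Proof. by apply: tlift_pure; split=> [y|x] k a b; rewrite ?pureDl ?pureDr. Qed.

Lemma tassoc_pure (U V W : vectType F) (u : U) (v : V) (w : W) :
  tassoc (u \ox (v \ox w)) = (u \ox v) \ox w.
Proof.
have H u' : tlift (fun v w => (u' \ox v) \ox w) (v \ox w) = (u' \ox v) \ox w.
  by apply: tlift_pure; split=> [y|x] k a b; rewrite ?pureDr ?pureDl.
rewrite -[RHS]H; apply: tlift_pure; split=> [y|x] k a b; last exact: linearP.
by apply: tlift_linear_fun => v' w'; rewrite !pureDl.
Qed.

End TensorMaps.

HB.mixin Record Falgebra_isHopf (F : fieldType) H of Falgebra F H := {
  comul : {lrmorphism H -> tensor H H};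
  counit : {lrmorphism H -> F^o};
  antipode : {linear H -> H};
  comulA : forall h : H,
    tmap comul id (comul h) = tassoc (tmap id comul (comul h));
  counitl : forall h : H, tlift (fun a b => counit a *: b) (comul h) = h;
  counitr : forall h : H, tlift (fun a b => counit b *: a) (comul h) = h;
  antipodel : forall h : H,
    tlift (fun a b => antipode a * b) (comul h) = (counit h)%:A;
  antipoder : forall h : H,
    tlift (fun a b => a * antipode b) (comul h) = (counit h)%:A
}.

#[short(type="hopfType")]
HB.structure Definition Hopf (F : fieldType) :=
  { H of Falgebra F H & Falgebra_isHopf F H }.

Definition hopf_iso (F : fieldType) (H K : hopfType F) : Prop :=
  exists f : {lrmorphism H -> K},
    [/\ bijective f,
        forall h, comul (f h) = tmap f f (comul h),
        forall h, counit (f h) = counit h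
      & forall h, antipode (f h) = f (antipode h)].

Section Quasitriangular.

Variables (F : fieldType) (H : hopfType F).
Implicit Type R : tensor H H.

(* R_12, R_13, R_23 and both sides of each hexagon identity live in
   (H \ox H) \ox H. *)
Definition leg12 R : tensor (tensor H H) H := R \ox 1.
Definition leg13 R : tensor (tensor H H) H :=
  tlift (fun a b => (a \ox 1) \ox b) R.
Definition leg23 R : tensor (tensor H H) H :=
  tlift (fun a b => (1 \ox a) \ox b) R.

Definition quasitriangular R : Prop :=
  [/\ R \is a GRing.unit,
      tmap comul id R = leg13 R * leg23 R,
      tassoc (tmap id comul R) = leg13 R * leg12 R
    & forall h : H, R * comul h = tswap (comul h) * R].

Definition triangular R : Prop := tswap R * R = 1 \ox 1.

End Quasitriangular.

Section DualNumbers.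

Variable F : fieldType.

Definition dual_numbers : Type := {poly %/ ('X^2 : {poly F})}.

HB.instance Definition _ := GRing.ComUnitAlgebra.on dual_numbers.
HB.instance Definition _ := Vector.copy dual_numbers
  {poly_(size (mk_monic ('X^2 : {poly F}))).-1 F}.

Fact dim_dual_numbers : \dim {:dual_numbers} = 2.
Proof. by rewrite dim_polyn mk_monic_Xn size_polyXn. Qed.

Definition dual_x : dual_numbers := 'qX.

Fact dual_modulus : mk_monic ('X^2 : {poly F}) = 'X^2.
Proof. by rewrite mk_monic_Xn. Qed.

Fact dual_x_sqr : dual_x * dual_x = 0.
Proof.
rewrite -[_ * _](in_qpolyM _ 'X 'X) -expr2; apply: val_inj => /=.
by rewrite dual_modulus Pdiv.RingMonic.rmodpp ?monicXn.
Qed.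

Lemma val_dual_x : val dual_x = 'X :> {poly F}.
Proof. by apply: qpolyXE; rewrite ?size_polyXn ?monicXn. Qed.

Lemma dual_coord (p : dual_numbers) :
  p = (val p)`_0 *: 1 + (val p)`_1 *: dual_x.
Proof.
apply: val_inj.
rewrite -[RHS]/((val p)`_0 *: 1 + (val p)`_1 *: val dual_x) val_dual_x.
apply/polyP=> i; rewrite coefD !coefZ coef1 coefX.
have szp : (size (val p) <= 2)%N.
  by rewrite (leq_trans (size_npoly p)) // dual_modulus size_polyXn.
case: i => [|[|i]]; rewrite /= ?mulr0 ?mulr1 ?addr0 ?add0r //.
by rewrite nth_default ?(leq_trans szp).
Qed.

(* Evaluation p(x) |-> p(a): the algebra map out of F[x]/<x^2> that sends the
   generator to a; it is one as soon as a^2 = 0. *)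
Section Eval.

Variables (A : falgType F) (a : A).

Definition dual_eval (p : dual_numbers) : A := horner_alg a (val p).

Lemma dual_eval_is_linear : linear dual_eval.
Proof.
move=> k p q; rewrite /dual_eval /= -mul_polyC rmorphD rmorphM /=.
by rewrite horner_algC mulr_algl.
Qed.

Hypothesis a2 : a * a = 0.

Lemma dual_eval_is_monoid_morphism : monoid_morphism dual_eval.
Proof.
split=> [|p q]; first exact: (rmorph1 (horner_alg a)).
rewrite /dual_eval -rmorphM /=; move: (polyn p * polyn q) => r.
rewrite dual_modulus [in RHS](Pdiv.RingMonic.rdivp_eq (monicXn _ 2) r).
have X2 : horner_alg a 'X^2 = 0 by rewrite expr2 rmorphM /= horner_algX.
by rewrite rmorphD rmorphM /= X2 mulr0 add0r.
Qed.

Lemma dual_evalX : dual_eval dual_x = a.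
Proof. by rewrite /dual_eval val_dual_x horner_algX. Qed.

End Eval.

(* In characteristic 2, x |-> x \ox 1 + 1 \ox x squares to zero, so that it
   extends to an algebra map making F[x]/<x^2> a Hopf algebra with x primitive. *)
Section Char2.

Local Notation G := dual_numbers.
Local Notation x := dual_x.

Definition dual_comul : G -> tensor G G := dual_eval (x \ox 1 + 1 \ox x).
Definition dual_counit : G -> F^o := dual_eval (0 : F^o).
Definition dual_antipode : G -> G := dual_eval (- x).

HB.instance Definition _ := GRing.isSemilinear.Build F G (tensor G G) _
  dual_comul (GRing.semilinear_linear (dual_eval_is_linear _)).
HB.instance Definition _ := GRing.isSemilinear.Build F G F^o _
  dual_counit (GRing.semilinear_linear (dual_eval_is_linear _)).
HB.instance Definition _ := GRing.isSemilinear.Build F G G _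
  dual_antipode (GRing.semilinear_linear (dual_eval_is_linear _)).

Lemma dual_eval1 (A : falgType F) (a : A) : dual_eval a 1 = 1.
Proof. exact: (rmorph1 (horner_alg a)). Qed.

Fact dual_comul1 : dual_comul 1 = 1 \ox 1.
Proof. exact: dual_eval1. Qed.
Fact dual_counit1 : dual_counit 1 = 1.
Proof. exact: dual_eval1. Qed.
Fact dual_antipode1 : dual_antipode 1 = 1.
Proof. exact: dual_eval1. Qed.
Fact dual_comulX : dual_comul x = x \ox 1 + 1 \ox x.
Proof. exact: dual_evalX. Qed.
Fact dual_counitX : dual_counit x = 0.
Proof. exact: dual_evalX. Qed.
Fact dual_antipodeX : dual_antipode x = - x.
Proof. exact: dual_evalX. Qed.

Lemma dual_ext (V : lmodType F) (f g : {linear G -> V}) :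
  f 1 = g 1 -> f x = g x -> f =1 g.
Proof.
move=> fg1 fgx p; rewrite (dual_coord p).
by rewrite !linearD !linearZ /= fg1 fgx.
Qed.

Fact dual_comulA h :
  tmap dual_comul id (dual_comul h) = tassoc (tmap id dual_comul (dual_comul h)).
Proof.
have tl u v : tmap dual_comul (@id G) (u \ox v) = dual_comul u \ox v.
  exact: (tmap_pure dual_comul idfun).
have tr u v : tmap (@id G) dual_comul (u \ox v) = u \ox dual_comul v.
  exact: (tmap_pure idfun dual_comul).
apply: (dual_ext (f := tmap dual_comul idfun \o dual_comul)
  (g := @tassoc _ G G G \o (tmap idfun dual_comul \o dual_comul))) h => /=.
  by rewrite dual_comul1 tl tr dual_comul1 tassoc_pure.
rewrite dual_comulX !linearD /= !tl !tr dual_comul1 dual_comulX.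
by rewrite pureDl1 pureDr1 linearD /= !tassoc_pure addrA.
Qed.

Fact dual_counitl h : tlift (fun a b => dual_counit a *: b) (dual_comul h) = h.
Proof.
have B : is_bilinear (fun a b : G => dual_counit a *: b).
  split=> [b|a] k y z; first by rewrite linearP scalerDl scalerA.
  by rewrite scalerDr !scalerA mulrC.
apply: (dual_ext (f := tlift (fun a b => dual_counit a *: b) \o dual_comul)
  (g := idfun)) h => /=.
  by rewrite dual_comul1 tlift_pure // dual_counit1 scale1r.
rewrite dual_comulX linearD /= !tlift_pure // dual_counit1 dual_counitX.
by rewrite scale0r add0r scale1r.
Qed.

Fact dual_counitr h : tlift (fun a b => dual_counit b *: a) (dual_comul h) = h.
Proof.
have B : is_bilinear (fun a b : G => dual_counit b *: a).
  split=> [b|a] k y z; last by rewrite linearP scalerDl scalerA.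
  by rewrite scalerDr !scalerA mulrC.
apply: (dual_ext (f := tlift (fun a b => dual_counit b *: a) \o dual_comul)
  (g := idfun)) h => /=.
  by rewrite dual_comul1 tlift_pure // dual_counit1 scale1r.
rewrite dual_comulX linearD /= !tlift_pure // dual_counit1 dual_counitX.
by rewrite scale0r addr0 scale1r.
Qed.

Fact dual_unit_counit_linear : linear (fun h : G => (dual_counit h)%:A : G).
Proof. by move=> k p q; rewrite linearP scalerDl -scalerA. Qed.

Let unit_counit : {linear G -> G} :=
  HB.pack (fun h : G => (dual_counit h)%:A : G)
    (GRing.isSemilinear.Build F G G _ (fun h : G => (dual_counit h)%:A : G)
      (GRing.semilinear_linear dual_unit_counit_linear)).

Fact dual_antipodel h :
  tlift (fun a b => dual_antipode a * b) (dual_comul h) = (dual_counit h)%:A.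
Proof.
have B : is_bilinear (fun a b => dual_antipode a * b).
  split=> [b|a] k y z; first by rewrite linearP mulrDl -scalerAl.
  by rewrite mulrDr -scalerAr.
apply: (dual_ext (f := tlift (fun a b => dual_antipode a * b) \o dual_comul)
  (g := unit_counit)) h => /=.
  by rewrite dual_comul1 tlift_pure // dual_antipode1 mulr1 dual_counit1 scale1r.
rewrite dual_comulX linearD /= !tlift_pure // dual_antipode1 dual_antipodeX.
by rewrite dual_counitX mulr1 mul1r addNr scale0r.
Qed.

Fact dual_antipoder h :
  tlift (fun a b => a * dual_antipode b) (dual_comul h) = (dual_counit h)%:A.
Proof.
have B : is_bilinear (fun a b => a * dual_antipode b).
  split=> [b|a] k y z; last by rewrite linearP mulrDr -scalerAr.
  by rewrite mulrDl -scalerAl.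
apply: (dual_ext (f := tlift (fun a b => a * dual_antipode b) \o dual_comul)
  (g := unit_counit)) h => /=.
  by rewrite dual_comul1 tlift_pure // dual_antipode1 mulr1 dual_counit1 scale1r.
rewrite dual_comulX linearD /= !tlift_pure // dual_antipode1 dual_antipodeX.
by rewrite dual_counitX mulr1 mul1r addrN scale0r.
Qed.

Hypothesis char2 : 2 \in [pchar F].

Fact dual_comul_sqr :
  (x \ox 1 + 1 \ox x) * (x \ox 1 + 1 \ox x) = 0 :> tensor G G.
Proof.
have D v : v + v = 0 :> tensor G G.
  by rewrite -mulr2n -scaler_nat (pcharf0 char2) scale0r.
rewrite mulrDl !mulrDr !pureM !mulr1 !mul1r dual_x_sqr pure0l pure0r.
by rewrite add0r addr0 D.
Qed.

Fact dual_comul_is_monoid_morphism : monoid_morphism dual_comul.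
Proof. exact: dual_eval_is_monoid_morphism dual_comul_sqr. Qed.

Fact dual_counit_is_monoid_morphism : monoid_morphism dual_counit.
Proof. by apply: dual_eval_is_monoid_morphism; rewrite mulr0. Qed.

End Char2.

End DualNumbers.

Definition grassmann : Type := dual_numbers 'F_2.

HB.instance Definition _ := Falgebra.on grassmann.

Definition grassmann_x : grassmann := dual_x 'F_2.

HB.instance Definition _ :=
  GRing.isMonoidMorphism.Build grassmann (tensor grassmann grassmann)
  (@dual_comul 'F_2) (dual_comul_is_monoid_morphism (pchar_Fp (isT : prime 2))).
HB.instance Definition _ := GRing.isMonoidMorphism.Build grassmann ('F_2)^o
  (@dual_counit 'F_2) (dual_counit_is_monoid_morphism 'F_2).

HB.instance Definition _ := Falgebra_isHopf.Build 'F_2 grassmann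
  (@dual_comulA 'F_2) (@dual_counitl 'F_2) (@dual_counitr 'F_2)
  (@dual_antipodel 'F_2) (@dual_antipoder 'F_2).

(* Main.v *)
Require Import Defs.
From HB Require Import structures.
From mathcomp Require Import all_boot all_order all_algebra all_field.

(* In a basis 1, e_1, ... adapted to H = F 1 + ker(counit), a Hopf algebra over
   F_2 of dimension n <= 3 with a quasitriangular structure R is a finite amount
   of boolean data: the structure constants of the product, the coproduct and
   the antipode, and the coefficients of R.  Applying the counit to the hexagon
   identities shows that R - 1 \ox 1 lies in ker(counit) \ox ker(counit), so
   that at most 8 + 8 + 4 bits (besides the antipode) are unknown.  An exhaustive
   search shows that associativity, coassociativity, multiplicativity of the
   coproduct, the hexagon identities and the antipode axiom force R = 1 \ox 1,
   unless n = 2, e_1 e_1 = 0 and e_1 is primitive, which is the Grassmann line.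
   Conversely R = 1 \ox 1 + x \ox x is quasitriangular as soon as x is primitive,
   has square zero and spans H together with 1. *)

Set Implicit Arguments.
Unset Strict Implicit.
Unset Printing Implicit Defensive.

Import GRing.Theory.
Local Open Scope ring_scope.

(** * Linear forms on tensor products *)

Section TensorForms.

Variable F : fieldType.

(** Pure tensors span, and 0 is itself pure, so closure under [a *: s + t] yields sums and multiples
    alike. Identities linear in a tensor thus reduce to pure tensors. *)
Lemma tensor_ind (U V : vectType F) (P : tensor U V -> Prop) :
    (forall a s t, P s -> P t -> P (a *: s + t)) ->
    (forall u v, P (u \ox v)) ->
  forall t, P t.
Proof.
move=> Plin Ppure t.
have P0 : P 0 by rewrite -(pure0l U (0 : V)); apply: Ppure.
have PD s s' : P s -> P s' -> P (s + s').
  by move=> Ps Ps'; rewrite -[s]scale1r; apply: Plin.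
rewrite (tensor_sum t); apply: big_ind => // i _; apply: big_ind => // j _.
by rewrite -[_ *: _]addr0; apply: Plin.
Qed.

Lemma pureZl (U V : vectType F) a (u : U) (v : V) :
  (a *: u) \ox v = a *: (u \ox v).
Proof. by rewrite -[a *: u]addr0 pureDl pure0l addr0. Qed.

Lemma pureZr (U V : vectType F) a (u : U) (v : V) :
  u \ox (a *: v) = a *: (u \ox v).
Proof. by rewrite -[a *: v]addr0 pureDr pure0r addr0. Qed.

(** The form f \ox g under F \ox F = F; for coordinate forms it reads off a coefficient of a
    tensor. *)
Definition tform (U V : vectType F) (f : U -> F^o) (g : V -> F^o) :
    tensor U V -> F^o :=
  tlift (fun u v => f u * g v : F^o).

HB.instance Definition _ (U V : vectType F) (f : U -> F^o) (g : V -> F^o) :=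
  GRing.Linear.on (tform f g).

Lemma tform_pure (U V : vectType F) (f : {linear U -> F^o})
    (g : {linear V -> F^o}) u v :
  tform f g (u \ox v) = f u * g v.
Proof.
apply: tlift_pure; split=> [y|x] a b c; rewrite linearP.
  by rewrite mulrDl -scalerAl.
by rewrite mulrDr -scalerAr.
Qed.

Lemma pure_sum (U V : vectType F) m n (a : nat -> F) (b : nat -> F)
    (u : nat -> U) (v : nat -> V) :
  (\sum_(i < m) a i *: u i) \ox (\sum_(j < n) b j *: v j)
    = \sum_(i < m) \sum_(j < n) (a i * b j) *: (u i \ox v j).
Proof.
apply/matrixP=> p q; rewrite mxE !linear_sum /= summxE mulr_suml.
apply: eq_bigr => i _; rewrite summxE mulr_sumr; apply: eq_bigr => j _.
by rewrite !linearZ /= !mxE mulrACA.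
Qed.

End TensorForms.

(** * Legs of R, and the counit applied to the hexagon identities *)

Section Legs.

Variables (F : fieldType) (H : hopfType F).

Lemma tmapl_pure (u v : H) : tmap comul (@id H) (u \ox v) = comul u \ox v.
Proof. exact: (tmap_pure comul idfun). Qed.

Lemma tmapr_pure (u v : H) : tmap (@id H) comul (u \ox v) = u \ox comul v.
Proof. exact: (tmap_pure idfun comul). Qed.

Lemma antipode_mul_bilinear :
  is_bilinear (fun a b : H => antipode a * b).
Proof.
split=> [y|x] k u v; first by rewrite linearP mulrDl -scalerAl.
by rewrite mulrDr -scalerAr.
Qed.

(** The antipode is only given as a linear map, so its value at 1 comes from the antipode axiom and
    the coproduct 1 \ox 1 of 1. *)
Lemma antipode1 : antipode (1 : H) = 1.
Proof.
have := antipodel (1 : H); rewrite !rmorph1 scale1r tensor1E.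
by rewrite tlift_pure ?mulr1 //; apply: antipode_mul_bilinear.
Qed.

Lemma leg13_pure (a b : H) : leg13 (a \ox b) = (a \ox 1) \ox b.
Proof.
by apply: tlift_pure; split=> [y|x] k u v; rewrite !(pureDl, pureDr).
Qed.

Lemma leg23_pure (a b : H) : leg23 (a \ox b) = (1 \ox a) \ox b.
Proof.
by apply: tlift_pure; split=> [y|x] k u v; rewrite !(pureDl, pureDr).
Qed.

Lemma leg13_linear : linear (@leg13 F H).
Proof. exact: linearP. Qed.

Lemma leg23_linear : linear (@leg23 F H).
Proof. exact: linearP. Qed.

Lemma leg12_linear : linear (@leg12 F H).
Proof. by move=> a s t; rewrite /leg12 pureDl. Qed.

Definition counit_l : tensor H H -> H :=
  tlift (fun a b : H => (counit a : F) *: b).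
Definition counit_r : tensor H H -> H :=
  tlift (fun a b : H => (counit b : F) *: a).

HB.instance Definition _ := GRing.Linear.on counit_l.
HB.instance Definition _ := GRing.Linear.on counit_r.

Lemma counit_l_pure a b : counit_l (a \ox b) = (counit a : F) *: b.
Proof.
apply: tlift_pure; split=> [y|x] k u v.
  by rewrite linearP scalerDl scalerA.
by rewrite scalerDr !scalerA mulrC.
Qed.

Lemma counit_r_pure a b : counit_r (a \ox b) = (counit b : F) *: a.
Proof.
apply: tlift_pure; split=> [y|x] k u v.
  by rewrite scalerDr !scalerA mulrC.
by rewrite linearP scalerDl scalerA.
Qed.

(** Applying the counit to the first factor of the first hexagon gives R = (1 \ox r) R with r =
    [counit_l R]. Cancelling the invertible R leaves 1 \ox 1 = 1 \ox r. *)
Lemma quasitriangular_counit_l (R : tensor H H) :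
  quasitriangular R -> counit_l R = 1.
Proof.
case=> R_unit hex _ _.
pose E : {linear tensor (tensor H H) H -> tensor H H} := tmap counit_l (@id H).
have E_pure s (b : H) : E (s \ox b) = counit_l s \ox b.
  exact: (tmap_pure counit_l idfun).
have El t : E (tmap comul (@id H) t) = t.
  elim/tensor_ind: t => [a s t es et|u v].
    by rewrite !linearP es et.
  by rewrite tmapl_pure E_pure [counit_l _]counitl.
have Er s t : E (leg13 s * leg23 t) = (1 \ox counit_l s) * t.
  elim/tensor_ind: s => [a s s' es es'|a b].
    rewrite leg13_linear linearP pureDr !mulrDl -!scalerAl -es -es'.
    exact: linearP.
  elim/tensor_ind: t => [c t t' et et'|c d].
    rewrite leg23_linear !mulrDr -!scalerAr -et -et'.
    exact: linearP.
  rewrite leg13_pure leg23_pure !pureM E_pure !mulr1 mul1r !counit_l_pure.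
  by rewrite -scalerAl pureZl pureZr.
have := congr1 E hex; rewrite El Er -{1}[R]mul1r => /(mulIr R_unit).
by move/(congr1 counit_l); rewrite tensor1E !counit_l_pure rmorph1 !scale1r.
Qed.

(** Mirror argument: the counit on the third factor of the second hexagon gives R = (r \ox 1) R with
    r = [counit_r R]. *)
Lemma quasitriangular_counit_r (R : tensor H H) :
  quasitriangular R -> counit_r R = 1.
Proof.
case=> R_unit _ hex _.
pose E : {linear tensor (tensor H H) H -> tensor H H} :=
  tlift (fun s b => (counit b : F) *: s).
have E_pure s (b : H) : E (s \ox b) = (counit b : F) *: s.
  apply: tlift_pure; split=> [y|x] k u v.
    by rewrite scalerDr !scalerA mulrC.
  by rewrite linearP scalerDl scalerA.
have El t : E (tassoc (tmap (@id H) comul t)) = t.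
  elim/tensor_ind: t => [a s t es et|u v].
    by rewrite !linearP es et.
  (* Once [v] on the right is recovered from its coproduct, both sides are linear in the tensor
     [comul v]. *)
  rewrite tmapr_pure -[v in RHS]counitr.
  elim/tensor_ind: (comul v) => [a s t es et|c d].
    by rewrite pureDr !linearP es et pureDr.
  by rewrite tassoc_pure E_pure [tlift _ _]counit_r_pure pureZr.
have Er s t : E (leg13 s * leg12 t) = (counit_r s \ox 1) * t.
  elim/tensor_ind: s => [a s s' es es'|a b].
    rewrite leg13_linear linearP pureDl !mulrDl -!scalerAl -es -es'.
    exact: linearP.
  elim/tensor_ind: t => [c t t' et et'|c d].
    rewrite leg12_linear !mulrDr -!scalerAr -et -et'.
    exact: linearP.
  rewrite leg13_pure /leg12 !pureM E_pure !mulr1 mul1r counit_r_pure -scalerAl.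
  by rewrite pureZl.
have := congr1 E hex; rewrite El Er -{1}[R]mul1r => /(mulIr R_unit).
by move/(congr1 counit_r); rewrite tensor1E !counit_r_pure rmorph1 !scale1r.
Qed.

End Legs.

(** * The Grassmann line *)

Section PrimitiveSquareZero.

Variables (F : fieldType) (H : hopfType F) (x : H).

(** An intrinsic description of the Grassmann line, which can be transported along isomorphisms. As
    [x] is nonzero and nilpotent, it is independent of 1. *)
Definition grassmann_generator : Prop :=
  [/\ x <> 0, x * x = 0, comul x = x \ox 1 + 1 \ox x
    & forall h : H, exists a b : F, h = a *: 1 + b *: x].

Hypothesis char2 : 2 \in [pchar F].
Hypothesis xP : grassmann_generator.

Local Notation R := (1 \ox 1 + x \ox x : tensor H H).

Let x2 : x * x = 0. Proof. by case: xP. Qed.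
Let comulx : comul x = x \ox 1 + 1 \ox x. Proof. by case: xP. Qed.

Let tswapR : tswap R = R.
Proof. by rewrite linearD /= !tswap_pure. Qed.

(** The cross terms add up to 2 (x \ox x), which vanishes in characteristic 2; hence R is its own
    inverse. *)
Let mulRR : R * R = 1.
Proof.
rewrite mulrDl !mulrDr !pureM !mulr1 !mul1r x2 pure0l addr0 -addrA.
by rewrite -mulr2n -scaler_nat (pcharf0 char2) scale0r addr0.
Qed.

Lemma grassmann_generator_triangular : triangular R.
Proof. by rewrite /triangular tswapR. Qed.

(** The diagonal coefficients of x \ox x are the squares of the coordinates of x, so x \ox x = 0
    would force x = 0. *)
Lemma grassmann_generator_nontrivial : R <> 1 \ox 1.
Proof.
move/(canRL (addKr _)); rewrite addNr => xx0; case: xP => x_neq0 _ _ _.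
apply: x_neq0; rewrite [x](coord_vbasis (memvf x)) big1 // => i _.
move/matrixP/(_ i i)/eqP: xx0; rewrite !mxE mulf_eq0 orbb => /eqP ->.
by rewrite scale0r.
Qed.

Lemma grassmann_generator_quasitriangular : quasitriangular R.
Proof.
split.
- by apply/unitrP; exists R.
- rewrite linearD /= !tmapl_pure rmorph1 comulx tensor1E pureDl1.
  rewrite /leg13 /leg23 !linearD /= -!/(leg13 _) -!/(leg23 _).
  rewrite !leg13_pure !leg23_pure.
  rewrite mulrDl !mulrDr !pureM !mulr1 !mul1r x2 pure0r addr0.
  by rewrite -addrA [(1 \ox x) \ox x + _]addrC.
- rewrite linearD /= !tmapr_pure rmorph1 comulx tensor1E pureDr1 !linearD /=.
  rewrite !tassoc_pure /leg12 pureDl1 /leg13 linearD /= -!/(leg13 _).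
  rewrite !leg13_pure.
  rewrite mulrDl !mulrDr !pureM !mulr1 !mul1r x2 !pure0l addr0.
  by rewrite -addrA.
move=> h; case: xP => _ _ _ /(_ h)[a [b ->]].
(* Each term of a product of x \ox x with the coproduct of x contains x x = 0. By linearity in h,
   only 1 and x have to be checked. *)
have Rx : R * comul x = comul x * R.
  rewrite comulx !mulrDl !mulrDr !pureM !mulr1 !mul1r x2 !pure0l !pure0r.
  by rewrite !addr0.
have swapx : tswap (comul x) = comul x.
  by rewrite comulx linearD /= !tswap_pure addrC.
have swap1 : tswap (1 : tensor H H) = 1 by rewrite !tensor1E tswap_pure.
rewrite !linearD !linearZ /= rmorph1 swapx swap1.
(* Generalizing R keeps distributivity from expanding R itself. *)
by move: R Rx => r rx; rewrite mulrDr mulrDl -!scalerAl -!scalerAr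
  rx mulr1 mul1r.
Qed.

End PrimitiveSquareZero.

Lemma grassmann_xP : grassmann_generator grassmann_x.
Proof.
split; first 1 last.
- exact: dual_x_sqr.
- exact: dual_comulX.
- by move=> h; exists (val h)`_0, (val h)`_1; apply: dual_coord.
by move/(congr1 val); rewrite val_dual_x; apply/eqP; rewrite polyX_eq0.
Qed.

Lemma tmapK (F : fieldType) (U V : vectType F) (f : {linear U -> V})
  (g : {linear V -> U}) : cancel f g -> cancel (tmap f f) (tmap g g).
Proof.
move=> fK t; elim/tensor_ind: t => [a s t es et|u v].
  by rewrite [tmap f f _]linearP [LHS]linearP /= es et.
by rewrite !tmap_pure !fK.
Qed.

(** * Isomorphism with the Grassmann line in terms of generators *)

Section GrassmannIso.

Variable H : hopfType 'F_2.

Lemma hopf_iso_generator :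
  hopf_iso H grassmann -> exists x : H, grassmann_generator x.
Proof.
case=> f [[g fK gK] f_comul _ _].
(* The inverse of a linear bijection is linear; the properties of [grassmann_x] are pulled back
   along it. *)
pose g' : {linear grassmann -> H} :=
  HB.pack g (GRing.isSemilinear.Build _ _ _ _ g
    (GRing.semilinear_linear (can2_linear fK gK))).
have [x_neq0 x2 comulx span] := grassmann_xP.
have g1 : g 1 = 1 by rewrite -(rmorph1 f) fK.
exists (g grassmann_x); split.
- by move/(congr1 f); rewrite gK rmorph0.
- apply: (can_inj fK); transitivity (f (g grassmann_x) * f (g grassmann_x)).
    exact: rmorphM.
  by rewrite gK x2 rmorph0.
- have := f_comul (g grassmann_x); rewrite gK comulx => /(congr1 (tmap g' g')).
  rewrite (tmapK (f := f) (g := g') fK) => <-.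
  by rewrite linearD /= !(tmap_pure g' g') /= g1.
move=> h; have [a [b fh]] := span (f h); exists a, b.
by rewrite -(fK h) fh -[g _]/(g' _) linearP linearZ /= g1.
Qed.

(** Evaluation at [x] is an algebra map from the dual numbers to H. The forms [counit] and [c] are
    dual to 1 and [x], so they give its inverse [q], which is therefore multiplicative.
    Compatibility with the other operations is checked on 1 and [x]. *)
Lemma generator_hopf_iso (x : H) (c : {linear H -> ('F_2)^o}) :
    grassmann_generator x -> counit x = 0 -> c 1 = 0 -> c x = 1 ->
  hopf_iso H grassmann.
Proof.
move=> [x_neq0 x2 comulx span] ex c1 cx.
pose p : {lrmorphism grassmann -> H} :=
  HB.pack (dual_eval x) (GRing.isSemilinear.Build _ grassmann H _ (dual_eval x)
    (GRing.semilinear_linear (dual_eval_is_linear x)))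
   (GRing.isMonoidMorphism.Build grassmann H (dual_eval x)
    (dual_eval_is_monoid_morphism x2)).
pose q (h : H) : grassmann :=
  (counit h : 'F_2) *: 1 + (c h : 'F_2) *: grassmann_x.
have px : dual_eval x grassmann_x = x := dual_evalX x.
have qlin : linear q.
  move=> a u v; rewrite /q [counit _]linearP [c _]linearP.
  by rewrite !scalerDl scalerDr -!scalerA addrACA.
pose q' : {linear H -> grassmann} :=
  HB.pack q (GRing.isSemilinear.Build _ _ _ _ q
    (GRing.semilinear_linear qlin)).
have q1 : q 1 = 1 by rewrite /q rmorph1 c1 scale1r scale0r addr0.
have qx : q x = grassmann_x by rewrite /q ex cx scale1r scale0r add0r.
have pK : cancel p q.
  apply: (dual_ext (f := q' \o p) (g := idfun)) => /=.
    by rewrite dual_eval1.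
  by rewrite px.
have qE a b : q (a *: 1 + b *: x) = a *: 1 + b *: grassmann_x.
  by rewrite -[LHS]/(q' _) linearP linearZ /= q1 qx.
have qK : cancel q p.
  move=> h; have [a [b ->]] := span h.
  by rewrite qE linearP linearZ /= dual_eval1 [X in _ + _ *: X]px.
pose f : {lrmorphism H -> grassmann} := HB.pack q q'
  (GRing.isMonoidMorphism.Build H grassmann q (can2_monoid_morphism pK qK)).
exists f; split.
- by exists p.
- move=> h; have [a [b ->]] := span h; rewrite [f _]qE.
  rewrite [comul (a *: 1 + _)]linearP [comul (_ + _)]linearP /= !linearZ /=.
  rewrite !rmorph1 comulx !tensor1E [RHS]linearP linearZ linearD /=.
  rewrite !(tmap_pure f f) /= q1 qx.
  by rewrite -[comul grassmann_x]/(dual_comul _) dual_comulX.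
- move=> h; have [a [b ->]] := span h; rewrite [f _]qE !linearP !linearZ /= ex.
  by rewrite !rmorph1 -[counit grassmann_x]/(dual_counit _) dual_counitX.
(* For primitive x with counit 0, the antipode axiom reads S(x) + x = 0. *)
have antipodex : antipode x = - x.
  have := antipodel x; rewrite ex scale0r comulx linearD /=.
  rewrite !(tlift_pure _ _ (@antipode_mul_bilinear _ H)).
  by rewrite antipode1 mulr1 mul1r => /eqP; rewrite addr_eq0 => /eqP.
move=> h; have [a [b ->]] := span h; rewrite [f _]qE.
rewrite [antipode (a *: 1 + b *: grassmann_x)]linearP.
rewrite [antipode (a *: 1 + b *: x)]linearP !linearZ /=.
(* The sign is moved into the scalar to match the shape of [qE]. *)
rewrite !antipode1 antipodex scalerN -scaleNr [RHS]qE.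
rewrite -[antipode grassmann_x]/(dual_antipode _) dual_antipodeX.
by rewrite dual_antipode1 scalerN scaleNr.
Qed.

End GrassmannIso.

(** * Structure constants in an adapted basis *)

Section StructureConstants.

Variables (F : fieldType) (H : hopfType F) (n : nat).
Variables (e : nat -> H) (k : nat -> {linear H -> F^o}).

(** Indices are natural numbers, meaningful below [n], which avoids casts between ordinals. Since
    [k 0] is the counit, the [e i] with 0 < i < n lie in its kernel. *)
Definition adapted_basis : Prop :=
  [/\ (0 < n)%N, forall h, h = \sum_(i < n) (k i h : F) *: e i,
      forall i j, (i < n)%N -> (j < n)%N -> k i (e j) = (i == j)%:R,
      e 0 = 1 & forall h, k 0 h = counit h].

Definition mulc i j l : F := k l (e i * e j).
Definition tcoef i j (t : tensor H H) : F := tform (k i) (k j) t.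
Definition comulc i j l : F := tcoef j l (comul (e i)).
Definition antipodec i j : F := k j (antipode (e i)).

Hypothesis eP : adapted_basis.

Let eE h : h = \sum_(i < n) (k i h : F) *: e i. Proof. by case: eP. Qed.
Let ke i j : (i < n)%N -> (j < n)%N -> k i (e j) = (i == j)%:R.
Proof. by case: eP => _ _ dual _ _; apply: dual. Qed.
Let e0 : e 0 = 1. Proof. by case: eP. Qed.
Let k0 h : k 0 h = counit h. Proof. by case: eP. Qed.
Let scaleE (a : F) (x : F^o) : a *: x = a * x. Proof. by []. Qed.
Let n_gt0 : (0 < n)%N. Proof. by case: eP. Qed.

Lemma tcoef_sum (t : tensor H H) :
  t = \sum_(i < n) \sum_(j < n) tcoef i j t *: (e i \ox e j).
Proof.
elim/tensor_ind: t => [a s t es et|u v].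
  rewrite {1}es {1}et scaler_sumr -big_split; apply: eq_bigr => i _ /=.
  rewrite scaler_sumr -big_split; apply: eq_bigr => j _ /=.
  by rewrite scalerA -scalerDl [in RHS]/tcoef linearP.
rewrite {1}[u]eE {1}[v]eE [LHS](@pure_sum F H H n n (k^~ u) (k^~ v) e e).
by apply: eq_bigr => i _; apply: eq_bigr => j _; rewrite /tcoef tform_pure.
Qed.

Lemma linear_tcoef (f : {linear tensor H H -> F^o}) t :
  f t = \sum_(i < n) \sum_(j < n) tcoef i j t * f (e i \ox e j) :> F.
Proof.
rewrite {1}[t]tcoef_sum linear_sum; apply: eq_bigr => i _ /=.
by rewrite linear_sum; apply: eq_bigr => j _ /=; rewrite linearZ.
Qed.

Lemma mulcE l a b :
  k l (a * b) = \sum_(i < n) \sum_(j < n) k i a * k j b * mulc i j l :> F.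
Proof.
rewrite {1}[a]eE {1}[b]eE mulr_suml linear_sum; apply: eq_bigr => i _.
rewrite mulr_sumr linear_sum; apply: eq_bigr => j _.
by rewrite -scalerAl -scalerAr scalerA linearZ.
Qed.

Lemma mulc0l j l : (j < n)%N -> (l < n)%N -> mulc 0 j l = (j == l)%:R.
Proof. by move=> jn ln; rewrite /mulc e0 mul1r ke // eq_sym. Qed.

Lemma mulc0r i l : (i < n)%N -> (l < n)%N -> mulc i 0 l = (i == l)%:R.
Proof. by move=> jn ln; rewrite /mulc e0 mulr1 ke // eq_sym. Qed.

Lemma counit_e i : (i < n)%N -> counit (e i) = (i == 0)%:R :> F.
Proof. by move=> i_n; rewrite -k0 ke // eq_sym. Qed.

(** The coefficient on e_0 is the counit, which is multiplicative and kills the other basis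
    vectors. *)
Lemma mulc0 i j : (i < n)%N -> (j < n)%N ->
  mulc i j 0 = ((i == 0) && (j == 0))%:R.
Proof.
by move=> i_n j_n; rewrite /mulc k0 rmorphM /= !counit_e // -natrM mulnb.
Qed.

Lemma mulcA i j m p :
  \sum_(l < n) mulc i j l * mulc l m p = \sum_(l < n) mulc j m l * mulc i l p.
Proof.
transitivity (k p (e i * e j * e m) : F).
  rewrite [e i * e j]eE mulr_suml linear_sum; apply: eq_bigr => l _ /=.
  by rewrite -scalerAl linearZ.
rewrite -mulrA [e j * e m]eE mulr_sumr linear_sum; apply: eq_bigr => l _ /=.
by rewrite -scalerAr linearZ.
Qed.

(** An index 0 amounts to the counit on that factor, which turns the counit axioms into values of
    coefficients. *)
Lemma tcoef0l j t : tcoef 0 j t = k j (counit_l t).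
Proof.
rewrite /tcoef; elim/tensor_ind: t => [a s t es et|u v].
  by rewrite !linearP /= es et.
by rewrite tform_pure counit_l_pure linearZ /= k0.
Qed.

Lemma tcoef0r i t : tcoef i 0 t = k i (counit_r t).
Proof.
rewrite /tcoef; elim/tensor_ind: t => [a s t es et|u v].
  by rewrite !linearP /= es et.
by rewrite tform_pure counit_r_pure linearZ /= k0 mulrC.
Qed.

Lemma comulc0l i l : (i < n)%N -> (l < n)%N -> comulc i 0 l = (l == i)%:R.
Proof. by move=> i_n l_n; rewrite /comulc tcoef0l [counit_l _]counitl ke. Qed.

Lemma comulc0r i l : (i < n)%N -> (l < n)%N -> comulc i l 0 = (l == i)%:R.
Proof. by move=> i_n l_n; rewrite /comulc tcoef0r [counit_r _]counitr ke. Qed.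

Lemma comulc0 j l : (j < n)%N -> (l < n)%N ->
  comulc 0 j l = ((j == 0) && (l == 0))%:R.
Proof.
move=> jn ln; rewrite /comulc e0 rmorph1 tensor1E /tcoef tform_pure -e0 !ke //.
by rewrite -natrM mulnb.
Qed.

Lemma tcoef_comul i j h :
  tcoef i j (comul h) = \sum_(l < n) k l h * comulc l i j.
Proof.
rewrite /comulc /tcoef {1}[h]eE !linear_sum; apply: eq_bigr => l _ /=.
by rewrite !linearZ.
Qed.

Definition tcoef3 p q r : tensor (tensor H H) H -> F^o :=
  tform (tform (k p) (k q)) (k r).
HB.instance Definition _ p q r := GRing.Linear.on (tcoef3 p q r).

Lemma tcoef3_pure p q r s (c : H) :
  tcoef3 p q r (s \ox c) = tcoef p q s * k r c.
Proof. exact: tform_pure. Qed.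

(** Together with [tcoef3_comul_r], this gives the coordinates of both sides of coassociativity and
    of the left sides of the hexagons. *)
Lemma tcoef3_comul_l p q r t :
  tcoef3 p q r (tmap comul (@id H) t)
    = \sum_(i < n) tcoef i r t * comulc i p q.
Proof.
elim/tensor_ind: t => [a s t es et|u v].
  rewrite !linearP /= es et scaler_sumr -big_split; apply: eq_bigr => i _ /=.
  by rewrite [in RHS]/tcoef linearP mulrDl !scaleE mulrA.
rewrite tmapl_pure tcoef3_pure tcoef_comul mulr_suml; apply: eq_bigr => i _.
by rewrite /tcoef tform_pure mulrAC.
Qed.

Lemma tcoef3_comul_r p q r t :
  tcoef3 p q r (tassoc (tmap (@id H) comul t))
    = \sum_(i < n) tcoef p i t * comulc i q r.
Proof.
elim/tensor_ind: t => [a s t es et|u v].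
  rewrite !linearP /= es et scaler_sumr -big_split; apply: eq_bigr => i _ /=.
  by rewrite [in RHS]/tcoef linearP mulrDl !scaleE mulrA.
(* With the factor of [u] split off, what remains is linear in [comul v], which allows a second
   induction. *)
transitivity (k p u * tcoef q r (comul v) : F).
  rewrite tmapr_pure; elim/tensor_ind: (comul v) => [a s t es et|c d].
    rewrite pureDr !linearP /= es et [in RHS]/tcoef linearP mulrDr.
    by rewrite !scaleE mulrCA.
  by rewrite tassoc_pure tcoef3_pure /tcoef !tform_pure mulrA.
rewrite tcoef_comul mulr_sumr; apply: eq_bigr => i _.
by rewrite /tcoef tform_pure mulrA.
Qed.

Lemma comulcA a p q r :
  \sum_(i < n) comulc a i r * comulc i p q
    = \sum_(i < n) comulc a p i * comulc i q r.
Proof. by rewrite -tcoef3_comul_l comulA tcoef3_comul_r. Qed.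

(** The coefficient of [s] stays outside the inner double sum, as in [bialgebra_table], where a zero
    coefficient skips that sum. *)
Lemma tcoefM p q s t :
  tcoef p q (s * t) = \sum_(i < n) \sum_(j < n) tcoef i j s *
    \sum_(l < n) \sum_(o < n) tcoef l o t * (mulc i l p * mulc j o q).
Proof.
rewrite /tcoef {1}[s]tcoef_sum mulr_suml linear_sum; apply: eq_bigr => i _ /=.
rewrite mulr_suml linear_sum; apply: eq_bigr => j _ /=.
rewrite -scalerAl linearZ /=; congr (_ * _).
rewrite {1}[t]tcoef_sum mulr_sumr linear_sum; apply: eq_bigr => l _ /=.
rewrite mulr_sumr linear_sum; apply: eq_bigr => o _ /=.
by rewrite -scalerAr linearZ /= pureM tform_pure.
Qed.

Lemma mulc_comulc a b p q :
  \sum_(c < n) mulc a b c * comulc c p q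
    = \sum_(i < n) \sum_(j < n) comulc a i j *
      \sum_(l < n) \sum_(o < n) comulc b l o * (mulc i l p * mulc j o q).
Proof. by rewrite -tcoef_comul rmorphM /= tcoefM. Qed.

(** On pure tensors the product is a \ox c \ox b d: only the third factor involves a structure
    constant. *)
Lemma tcoef3_leg13_leg23 i j l s t :
  tcoef3 i j l (leg13 s * leg23 t)
    = \sum_(p < n) \sum_(q < n) tcoef i p s * tcoef j q t * mulc p q l.
Proof.
elim/tensor_ind: s => [a s s' es es'|a b].
  rewrite leg13_linear mulrDl -scalerAl linearP /= es es' scaler_sumr.
  rewrite -big_split; apply: eq_bigr => p _ /=.
  rewrite scaler_sumr -big_split; apply: eq_bigr => q _ /=.
  by rewrite [in RHS]/tcoef linearP !mulrDl !scaleE !mulrA.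
elim/tensor_ind: t => [c t t' et et'|c d].
  rewrite leg23_linear mulrDr -scalerAr linearP /= et et' scaler_sumr.
  rewrite -big_split; apply: eq_bigr => p _ /=.
  rewrite scaler_sumr -big_split; apply: eq_bigr => q _ /=.
  by rewrite [in RHS]/tcoef linearP mulrDr mulrDl !scaleE !mulrA
    [_ * c]mulrC.
rewrite leg13_pure leg23_pure !pureM mulr1 mul1r tcoef3_pure mulcE mulr_sumr.
apply: eq_bigr => p _; rewrite mulr_sumr; apply: eq_bigr => q _.
by rewrite /tcoef !tform_pure !mulrA; congr (_ * _); rewrite -!mulrA;
  congr (_ * _); rewrite mulrCA.
Qed.

(** Here the product is a c \ox d \ox b, so the structure constant sits in the first factor. *)
Lemma tcoef3_leg13_leg12 i j l s t :
  tcoef3 i j l (leg13 s * leg12 t)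
    = \sum_(p < n) \sum_(q < n) tcoef p l s * tcoef q j t * mulc p q i.
Proof.
elim/tensor_ind: s => [a s s' es es'|a b].
  rewrite leg13_linear mulrDl -scalerAl linearP /= es es' scaler_sumr.
  rewrite -big_split; apply: eq_bigr => p _ /=.
  rewrite scaler_sumr -big_split; apply: eq_bigr => q _ /=.
  by rewrite [in RHS]/tcoef linearP !mulrDl !scaleE !mulrA.
elim/tensor_ind: t => [c t t' et et'|c d].
  rewrite leg12_linear mulrDr -scalerAr linearP /= et et' scaler_sumr.
  rewrite -big_split; apply: eq_bigr => p _ /=.
  rewrite scaler_sumr -big_split; apply: eq_bigr => q _ /=.
  by rewrite [in RHS]/tcoef linearP mulrDr mulrDl !scaleE !mulrA
    [_ * c]mulrC.
rewrite leg13_pure /leg12 !pureM mulr1 mul1r tcoef3_pure /tcoef tform_pure.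
rewrite mulcE !mulr_suml; apply: eq_bigr => p _.
rewrite !mulr_suml; apply: eq_bigr => q _.
have swap (x y m z w : F) : x * y * m * z * w = x * w * (y * z) * m.
  by rewrite -!mulrA (mulrC m) -!mulrA [w * (y * _)]mulrCA [z * (w * _)]mulrCA.
by rewrite !tform_pure; apply: swap.
Qed.

Lemma antipodec0 j : (j < n)%N -> antipodec 0 j = (j == 0)%:R.
Proof. by move=> jn; rewrite /antipodec e0 antipode1 -e0 ke. Qed.

Lemma antipodecE i p : (i < n)%N -> (p < n)%N ->
  \sum_(j < n) \sum_(m < n) comulc i j m *
    \sum_(l < n) antipodec j l * mulc l m p = ((i == 0) && (p == 0))%:R.
Proof.
move=> i_n p_n.
transitivity (k p (tlift (fun a b => antipode a * b) (comul (e i))) : F).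
  rewrite [RHS](linear_tcoef (k p \o tlift _)); apply: eq_bigr => j _ /=.
  apply: eq_bigr => m _; rewrite (tlift_pure _ _ (@antipode_mul_bilinear F H)).
  congr (_ * _).
  rewrite [antipode _]eE mulr_suml linear_sum; apply: eq_bigr => l _ /=.
  by rewrite -scalerAl linearZ.
rewrite antipodel linearZ /= counit_e // -e0 ke //.
by rewrite -[_ *: _]/(_ * _) -natrM mulnb.
Qed.

(** * Coefficients of a quasitriangular structure *)

Section Quasitriangular.

Variable R : tensor H H.
Hypothesis R_qt : quasitriangular R.

Lemma quasitriangular_coef0l j : (j < n)%N -> tcoef 0 j R = (j == 0)%:R.
Proof. by move=> jn; rewrite tcoef0l quasitriangular_counit_l // -e0 ke. Qed.

Lemma quasitriangular_coef0r i : (i < n)%N -> tcoef i 0 R = (i == 0)%:R.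
Proof. by move=> i_n; rewrite tcoef0r quasitriangular_counit_r // -e0 ke. Qed.

Lemma quasitriangular_hexl i j l :
  \sum_(m < n) tcoef m l R * comulc m i j
    = \sum_(p < n) \sum_(q < n) tcoef i p R * tcoef j q R * mulc p q l.
Proof.
case: R_qt => _ hex _ _.
by rewrite -tcoef3_comul_l hex tcoef3_leg13_leg23.
Qed.

Lemma quasitriangular_hexr i j l :
  \sum_(m < n) tcoef i m R * comulc m j l
    = \sum_(p < n) \sum_(q < n) tcoef p l R * tcoef q j R * mulc p q i.
Proof.
case: R_qt => _ _ hex _.
by rewrite -tcoef3_comul_r hex tcoef3_leg13_leg12.
Qed.

(** By the counit identities, row 0 and column 0 of the coefficients of R agree with those of 1 \ox
    1. *)
Lemma quasitriangular_coefs :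
  R = 1 \ox 1
    + \sum_(1 <= i < n) \sum_(1 <= j < n) tcoef i j R *: (e i \ox e j).
Proof.
rewrite {1}[R]tcoef_sum -(big_mkord xpredT
  (fun i => \sum_(j < n) tcoef i j R *: (e i \ox e j))) big_ltn //.
congr (_ + _).
  rewrite -(big_mkord xpredT (fun j => tcoef 0 j R *: (e 0 \ox e j))).
  rewrite big_ltn //.
  rewrite quasitriangular_coef0l // scale1r e0 big1_seq ?addr0 // => j.
  rewrite mem_index_iota => /andP[_ /andP[j_gt0 jn]].
  by rewrite quasitriangular_coef0l // gtn_eqF // scale0r.
apply: eq_big_nat => i /andP[i_gt0 i_n].
rewrite -(big_mkord xpredT (fun j => tcoef i j R *: (e i \ox e j))) big_ltn //.
by rewrite quasitriangular_coef0r // gtn_eqF // scale0r add0r.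
Qed.

End Quasitriangular.

End StructureConstants.

(** * The exhaustive search *)

Section BooleanTables.

Local Open Scope nat_scope.

Fixpoint xorsum n (f : nat -> bool) : bool :=
  if n is m.+1 then xorsum m f (+) f m else false.

(* [if] rather than [&&] here and below: [vm_compute] evaluates both arguments
   of [&&], which would rule out any early exit from the search. *)
Fixpoint below n (P : pred nat) : bool :=
  if n is m.+1 then if P m then below m P else false else true.

Lemma belowT n (P : pred nat) : (forall i, i < n -> P i) -> below n P.
Proof.
elim: n => //= n IHn Pn; rewrite Pn //; apply: IHn => i i_n.
by apply: Pn; apply: leqW.
Qed.

Fixpoint bitseqs n : seq bitseq :=
  if n is m.+1 then
    [seq false :: s | s <- bitseqs m] ++ [seq true :: s | s <- bitseqs m]
  else [:: [::]].

Lemma mem_bitseqs s : s \in bitseqs (size s).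
Proof.
elim: s => //= b s IHs; rewrite mem_cat; apply/orP.
by case: b; [right | left]; apply: map_f.
Qed.

Variable n : nat.
Implicit Types M D : nat -> nat -> nat -> bool.

(* Entries with an index 0 are dictated by the unit and the counit; [b] lists
   the others in lexicographic order. *)
Definition table3 (b : bitseq) i j l : bool :=
  if i == 0 then j == l else if j == 0 then i == l else if l == 0 then false
  else nth false b ((i.-1 * n.-1 + j.-1) * n.-1 + l.-1).

Definition code3 M : bitseq :=
  let r := iota 1 n.-1 in
  flatten [seq flatten [seq [seq M i j l | l <- r] | j <- r] | i <- r].

Definition table2 (b : bitseq) i j : bool :=
  if i == 0 then j == 0 else if j == 0 then false
  else nth false b (i.-1 * n.-1 + j.-1).

Definition code2 (C : nat -> nat -> bool) : bitseq :=
  let r := iota 1 n.-1 in flatten [seq [seq C i j | j <- r] | i <- r].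

(** Only row 0 is prescribed, by S(1) = 1; the other rows keep all [n] columns, hence (n - 1) n free
    bits. *)
Definition table_antipode (b : bitseq) i j : bool :=
  if i == 0 then j == 0 else nth false b (i.-1 * n + j).

Definition code_antipode (S : nat -> nat -> bool) : bitseq :=
  flatten [seq [seq S i j | j <- iota 0 n] | i <- iota 1 n.-1].

Definition assoc_table M : bool :=
  below n (fun i => below n (fun j => below n (fun k => below n (fun p =>
    xorsum n (fun l => M i j l && M l k p)
      == xorsum n (fun l => M j k l && M i l p))))).

(* [D i j l] stands for the coefficient of e_i \ox e_j in the coproduct of e_l. *)
Definition bialgebra_table M D : bool :=
  below n (fun a => below n (fun b => below n (fun p => below n (fun q =>
    xorsum n (fun c => M a b c && D p q c)
      == xorsum n (fun i => xorsum n (fun j => if D i j a then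
           xorsum n (fun l => xorsum n (fun o => if D l o b then
             M i l p && M j o q else false)) else false)))))).

Definition hexagon_table M D (C : nat -> nat -> bool) : bool :=
  below n (fun i => below n (fun j => below n (fun l =>
    (xorsum n (fun m => C m l && D i j m)
      == xorsum n (fun p => xorsum n (fun q => C i p && C j q && M p q l)))
  && (xorsum n (fun m => C i m && D j l m)
      == xorsum n (fun p => xorsum n (fun q => C p l && C q j && M p q i)))))).

Definition antipode_table M D (S : nat -> nat -> bool) : bool :=
  below n (fun i => below n (fun p =>
    xorsum n (fun j => xorsum n (fun m => D j m i &&
      xorsum n (fun l => S j l && M l m p))) == (i == 0) && (p == 0))).

(** These are also the candidates for the coproduct, coassociativity being associativity of the dual
    algebra. *)
Definition assoc_codes : seq bitseq :=
  [seq b <- bitseqs (n.-1 * n.-1 * n.-1) | assoc_table (table3 b)].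

(** Antipodes are enumerated last, only for a bialgebra with a nonzero solution of the hexagons
    outside the exceptional case. In that case the single free bit of each table is zero: e_1 e_1 =
    0 and e_1 is primitive. *)
Definition only_grassmann : bool :=
  all (fun m => all (fun d =>
    if bialgebra_table (table3 m) (table3 d) then
      all (fun c =>
        if if has id c && ~~ [&& n == 2, m == [:: false] & d == [:: false]]
           then hexagon_table (table3 m) (table3 d) (table2 c) else false
        then all (fun s =>
            ~~ antipode_table (table3 m) (table3 d) (table_antipode s))
          (bitseqs (n.-1 * n))
        else true)
      (bitseqs (n.-1 * n.-1))
    else true) assoc_codes) assoc_codes.

(** Soundness of the search: the lengths of the codes place them in the enumerated lists. *)
Lemma only_grassmannP m d c s :
    only_grassmann ->
    size m = n.-1 * n.-1 * n.-1 -> size d = n.-1 * n.-1 * n.-1 ->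
    size c = n.-1 * n.-1 -> size s = n.-1 * n ->
    assoc_table (table3 m) -> assoc_table (table3 d) ->
    bialgebra_table (table3 m) (table3 d) ->
    hexagon_table (table3 m) (table3 d) (table2 c) ->
    antipode_table (table3 m) (table3 d) (table_antipode s) ->
  has id c -> [/\ n = 2, m = [:: false] & d = [:: false]].
Proof.
move=> ok m_sz d_sz c_sz s_sz mA dA md hex anti c_nz.
have m_in : m \in assoc_codes by rewrite mem_filter mA -m_sz mem_bitseqs.
have d_in : d \in assoc_codes by rewrite mem_filter dA -d_sz mem_bitseqs.
have := allP (allP ok _ m_in) _ d_in; rewrite md => /allP/(_ c).
rewrite -c_sz mem_bitseqs c_nz hex /= => /(_ isT).
case: and3P => [[/eqP ? /eqP ? /eqP ?] //|_] /allP/(_ s).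
by rewrite -s_sz mem_bitseqs anti => /(_ isT).
Qed.

Lemma size_code3 M : size (code3 M) = n.-1 * n.-1 * n.-1.
Proof.
rewrite /code3; move: n.-1 => k.
have flatsz (T : Type) (f : nat -> seq T) sz r :
    (forall i, size (f i) = sz) ->
  size (flatten [seq f i | i <- r]) = size r * sz.
  by move=> fsz; elim: r => //= i r IHr; rewrite size_cat IHr fsz.
rewrite (flatsz _ _ (k * k)) ?size_iota ?mulnA // => i.
by rewrite (flatsz _ _ k) ?size_iota // => j; rewrite size_map size_iota.
Qed.

End BooleanTables.

(** For n = 3 the product, coproduct, R and antipode have 8, 8, 4 and 6 free bits. For n <= 1 the
    code of R is empty and the claim vacuous. *)
Lemma only_grassmann_le3 n : (n <= 3)%N -> only_grassmann n.
Proof. by case: n => [|[|[|[|//]]]] _; vm_compute. Qed.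

(** * From structure constants to boolean tables *)

Section TablesOfCodes.
Local Open Scope nat_scope.

Variable n : nat.
Hypothesis n_le3 : n <= 3.

(** The hypotheses are the normalization built into [table3]; at the other entries, the position
    formula is checked case by case. *)
Lemma table3K M i j l :
    (forall j l, j < n -> l < n -> M 0 j l = (j == l)) ->
    (forall i l, i < n -> l < n -> M i 0 l = (i == l)) ->
    (forall i j, i < n -> j < n -> M i j 0 = (i == 0) && (j == 0)) ->
  i < n -> j < n -> l < n -> table3 n (code3 n M) i j l = M i j l.
Proof.
move=> M0l M0r M0; case: i => [|i] i_n jn ln; first by rewrite M0l.
case: j => [|j] in jn *; first by rewrite M0r.
case: l => [|l] in ln *; first by rewrite M0.
move: n_le3 i_n jn ln {M0l M0r M0}; case: n => [|[|[|[|//]]]] // _.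
  by case: i j l => [|//] [|//] [|//].
by case: i j l => [|[|//]] [|[|//]] [|[|//]].
Qed.

Lemma table2K C i j :
    (forall j, j < n -> C 0 j = (j == 0)) ->
    (forall i, i < n -> C i 0 = (i == 0)) ->
  i < n -> j < n -> table2 n (code2 n C) i j = C i j.
Proof.
move=> C0l C0r; case: i => [|i] i_n jn; first by rewrite C0l.
case: j => [|j] in jn *; first by rewrite C0r.
move: n_le3 i_n jn {C0l C0r}; case: n => [|[|[|[|//]]]] // _.
  by case: i j => [|//] [|//].
by case: i j => [|[|//]] [|[|//]].
Qed.

Lemma table_antipodeK S i j :
    (forall j, j < n -> S 0 j = (j == 0)) ->
  i < n -> j < n -> table_antipode n (code_antipode n S) i j = S i j.
Proof.
move=> S0; case: i => [|i] i_n jn; first by rewrite S0.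
move: n_le3 i_n jn {S0}; case: n => [|[|[|[|//]]]] // _.
  by case: i j => [|//] [|[|//]].
by case: i j => [|[|//]] [|[|[|//]]].
Qed.

Lemma size_code2 C : size (code2 n C) = n.-1 * n.-1.
Proof. by case: n n_le3 => [|[|[|[|//]]]]. Qed.

Lemma size_code_antipode S : size (code_antipode n S) = n.-1 * n.
Proof. by case: n n_le3 => [|[|[|[|//]]]]. Qed.

End TablesOfCodes.

(** * Arithmetic of F_2 as boolean arithmetic, through nonvanishing *)

Section F2.

Implicit Types x y : 'F_2.

Lemma F2_neq0D x y : (x + y != 0) = (x != 0) (+) (y != 0).
Proof. by case: x y => [[|[|//]] ?] [[|[|//]] ?]. Qed.

(** With equations as premises, each factor is translated separately into its table entry. *)
Lemma F2_neq0M x y a b :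
  (x != 0) = a -> (y != 0) = b -> (x * y != 0) = a && b.
Proof. by move=> <- <-; rewrite mulf_eq0 negb_or. Qed.

Lemma F2_bool x : x = (x != 0)%:R.
Proof. by apply: val_inj; case: x => [[|[|//]] ?]. Qed.

Lemma F2_bool_neq0 (b : bool) : (b%:R != 0 :> 'F_2) = b.
Proof. by case: b. Qed.

Lemma F2_neq0_sum n (f : nat -> 'F_2) g :
    (forall i, (i < n)%N -> (f i != 0) = g i) ->
  (\sum_(i < n) f i != 0) = xorsum n g.
Proof.
elim: n => [|n IHn] fg; first by rewrite big_ord0 eqxx.
rewrite big_ord_recr F2_neq0D /= fg // IHn // => i i_n.
by apply: fg; apply: leqW.
Qed.

Lemma F2_eq_sum m n (f1 f2 : nat -> 'F_2) g1 g2 :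
    (forall i, (i < m)%N -> (f1 i != 0) = g1 i) ->
    (forall i, (i < n)%N -> (f2 i != 0) = g2 i) ->
  \sum_(i < m) f1 i = \sum_(i < n) f2 i -> xorsum m g1 == xorsum n g2.
Proof.
by move=> fg1 fg2 E; rewrite -(F2_neq0_sum fg1) -(F2_neq0_sum fg2) E.
Qed.

Lemma F2_sum_eqb n (f : nat -> 'F_2) g (b : bool) :
    (forall i, (i < n)%N -> (f i != 0) = g i) ->
  \sum_(i < n) f i = b%:R -> xorsum n g == b.
Proof. by move=> fg E; rewrite -(F2_neq0_sum fg) E F2_bool_neq0. Qed.

End F2.

(** * The boolean tables of a quasitriangular Hopf algebra over F_2 *)

Section Tables.

Variables (H : hopfType 'F_2) (n : nat) (e : nat -> H).
Variable k : nat -> {linear H -> ('F_2)^o}.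
Hypotheses (n_le3 : (n <= 3)%N) (eP : adapted_basis n e k).
Variable R : tensor H H.
Hypothesis R_qt : quasitriangular R.

Let m := code3 n (fun i j l => mulc e k i j l != 0).
(* Transposed, the coproduct constants are those of the dual algebra, whose
   unit is the counit: they obey the same normalization as those of the product. *)
Let d := code3 n (fun i j l => comulc e k l i j != 0).
Let c := code2 n (fun i j => tcoef k i j R != 0).
Let s := code_antipode n (fun i j => antipodec e k i j != 0).

Let mE i j l : (i < n)%N -> (j < n)%N -> (l < n)%N ->
  (mulc e k i j l != 0) = table3 n m i j l.
Proof.
move=> i_n jn ln; rewrite /m table3K // => {i j l i_n jn ln} i j i_n jn.
- by rewrite (mulc0l eP) // F2_bool_neq0.
- by rewrite (mulc0r eP) // F2_bool_neq0.
- by rewrite (mulc0 eP) // F2_bool_neq0.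
Qed.

Let dE i j l : (i < n)%N -> (j < n)%N -> (l < n)%N ->
  (comulc e k l i j != 0) = table3 n d i j l.
Proof.
move=> i_n jn ln; rewrite /d table3K // => {i j l i_n jn ln} i j i_n jn.
- by rewrite (comulc0l eP) // F2_bool_neq0.
- by rewrite (comulc0r eP) // F2_bool_neq0.
- by rewrite (comulc0 eP) // F2_bool_neq0.
Qed.

Let cE i j : (i < n)%N -> (j < n)%N -> (tcoef k i j R != 0) = table2 n c i j.
Proof.
move=> i_n jn; rewrite /c table2K // => {i j i_n jn} i i_n.
  by rewrite (quasitriangular_coef0l eP R_qt) // F2_bool_neq0.
by rewrite (quasitriangular_coef0r eP R_qt) // F2_bool_neq0.
Qed.

Let sE i j : (i < n)%N -> (j < n)%N ->
  (antipodec e k i j != 0) = table_antipode n s i j.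
Proof.
move=> i_n jn; rewrite /s table_antipodeK // => {i j i_n jn} i i_n.
by rewrite (antipodec0 eP) // F2_bool_neq0.
Qed.

(** Each axiom in coordinates equates sums over F_2; nonvanishing turns these into the exclusive ors
    tested by the tables. *)
Lemma quasitriangular_has_id :
  has id c -> [/\ n = 2, m = [:: false] & d = [:: false]].
Proof.
apply: (only_grassmannP (only_grassmann_le3 n_le3) (size_code3 _ _)
  (size_code3 _ _) (size_code2 n_le3 _) (size_code_antipode n_le3 _)).
- apply: belowT => i i_n; apply: belowT => j jn.
  apply: belowT => o on; apply: belowT => p pn.
  apply: F2_eq_sum (mulcA eP i j o p) => l ln.
    by apply: F2_neq0M; apply: mE.
  by apply: F2_neq0M; apply: mE.
- apply: belowT => i i_n; apply: belowT => j jn.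
  apply: belowT => o on; apply: belowT => p pn.
  (* For the transposed constants this is associativity, once the two factors of each summand are
     exchanged. *)
  have dA := comulcA eP p i j o.
  rewrite (eq_bigr (fun l : 'I_n => comulc e k l i j * comulc e k p l o)) in dA;
    last by move=> l _; rewrite mulrC.
  rewrite [RHS](eq_bigr (fun l : 'I_n => comulc e k l j o * comulc e k p i l))
    in dA; last by move=> l _; rewrite mulrC.
  apply: F2_eq_sum dA => l ln.
    by apply: F2_neq0M; apply: dE.
  by apply: F2_neq0M; apply: dE.
- apply: belowT => a an; apply: belowT => b bn.
  apply: belowT => p pn; apply: belowT => q qn.
  apply: F2_eq_sum (mulc_comulc eP a b p q) => i i_n.
    by apply: F2_neq0M; [apply: mE | apply: dE].
  apply: F2_neq0_sum => j jn; apply: F2_neq0M; first exact: dE.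
  apply: F2_neq0_sum => l ln; apply: F2_neq0_sum => o on.
  by apply: F2_neq0M; [apply: dE | apply: F2_neq0M; apply: mE].
- apply: belowT => i i_n; apply: belowT => j jn; apply: belowT => l ln.
  apply/andP; split.
    apply: F2_eq_sum (quasitriangular_hexl eP R_qt i j l) => p pn.
      by apply: F2_neq0M; [apply: cE | apply: dE].
    apply: F2_neq0_sum => q qn; apply: F2_neq0M; last exact: mE.
    by apply: F2_neq0M; apply: cE.
  apply: F2_eq_sum (quasitriangular_hexr eP R_qt i j l) => p pn.
    by apply: F2_neq0M; [apply: cE | apply: dE].
  apply: F2_neq0_sum => q qn; apply: F2_neq0M; last exact: mE.
  by apply: F2_neq0M; apply: cE.
apply: belowT => i i_n; apply: belowT => p pn.
apply: F2_sum_eqb (antipodecE eP i_n pn) => j jn.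
apply: F2_neq0_sum => l ln; apply: F2_neq0M; first exact: dE.
by apply: F2_neq0_sum => q qn; apply: F2_neq0M; [apply: sE | apply: mE].
Qed.

End Tables.

(** * Classification in dimension at most 3 *)

(** Since the counit of 1 is 1, H is the direct sum of F 1 and the kernel K; the basis is 1 followed
    by a basis of K. *)
Lemma exists_adapted_basis (F : fieldType) (H : hopfType F) :
  exists n (e : nat -> H) (k : nat -> {linear H -> F^o}),
    (n <= \dim {:H})%N /\ adapted_basis n e k.
Proof.
pose K := lker (linfun (counit : {linear H -> F^o})).
have memK h : (h \in K) = (counit h == 0) by rewrite memv_ker lfunE.
have K1 : 1 \notin K by rewrite memK rmorph1 oner_eq0.
pose B := [tuple of 1 :: vbasis K].
have B_basis : basis_of {:H} B.
  rewrite /basis_of /= free_cons (span_basis (vbasisP K)) K1.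
  rewrite (basis_free (vbasisP K)) andbT eqEsubv subvf andbT.
  apply/subvP => h _; rewrite span_cons (span_basis (vbasisP K)).
  rewrite -(subrKC ((counit h : F) *: 1) h); apply: memv_add.
    by apply: memvZ; apply: memv_line.
  by rewrite memK linearB linearZ /= rmorph1 -[_ *: _]/(_ * _) mulr1 subrr.
have B_free := basis_free B_basis.
pose n := (\dim K).+1.
pose k i : {linear H -> F^o} := HB.pack (coord B (inord i) : H -> F^o)
  (GRing.isSemilinear.Build F H F^o _ (coord B (inord i) : H -> F^o)
     (GRing.semilinear_linear (@coord_is_scalar _ _ _ B (inord i)))).
have ke i j : (i < n)%N -> (j < n)%N -> k i B`_j = (i == j)%:R.
  move=> i_n jn; rewrite -[j in LHS](inordK jn) [LHS]coord_free //.
  by rewrite -val_eqE /= !inordK // eq_sym.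
have expand h : h = \sum_(i < n) (k i h : F) *: B`_i.
  rewrite {1}(coord_basis B_basis (memvf h)).
  by apply: eq_bigr => i _ /=; rewrite inord_val.
have counitB i : (i < n)%N -> counit B`_i = (i == 0)%:R :> F.
  case: i => [|i] i_n; first by rewrite rmorph1.
  apply/eqP; rewrite -memK; apply: vbasis_mem.
  by apply: mem_nth; rewrite size_tuple.
exists n, (nth 0 B), k; split; last split=> // h.
  (* If K had the dimension of H, it would be all of H and contain 1. *)
  rewrite ltnNge; apply: contra K1 => dimK.
  by have /eqP -> : K == fullv; rewrite ?memvf // eqEdim subvf.
(* Applying the counit to the expansion of h leaves only the term of B_0 = 1. *)
rewrite {2}[h]expand linear_sum big_ord_recl /= big1 => [|i _].
  by rewrite addr0 linearZ /= rmorph1 -[_ *: _]/(_ * _) mulr1.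
rewrite linearZ /= [counit _](counitB i.+1 (ltn_ord i)).
by rewrite -[_ *: _]/(_ * _) mulr0.
Qed.

(** The search leaves only n = 2 with both codes zero, so e_1 is the generator and [k 1] its
    coordinate form. *)
Lemma quasitriangular_generator (H : hopfType 'F_2) (R : tensor H H) :
    (\dim {:H} <= 3)%N -> quasitriangular R -> R <> 1 \ox 1 ->
  exists (x : H) (c : {linear H -> ('F_2)^o}),
    [/\ grassmann_generator x, counit x = 0, c 1 = 0, c x = 1
      & R = 1 \ox 1 + x \ox x].
Proof.
move=> dimH R_qt R_neq1.
have [n [e [k [n_le eP]]]] := exists_adapted_basis H.
have n_le3 := leq_trans n_le dimH.
have n_gt0 : (0 < n)%N by case: eP.
have RE := quasitriangular_coefs eP R_qt.
have c_neq0 : has id (code2 n (fun i j => tcoef k i j R != 0)).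
  apply: contra_notT R_neq1 => /hasPn c0; rewrite RE big1_seq ?addr0 // => i.
  rewrite mem_index_iota => /andP[_ /andP[i_gt0 i_n]].
  rewrite big1_seq // => j; rewrite mem_index_iota => /andP[_ /andP[j_gt0 jn]].
  suff /eqP -> : tcoef k i j R == 0 by rewrite scale0r.
  (* A nonzero coefficient would put [true] into the code. *)
  apply: contraT => cij; have := c0 true; apply; apply/flatten_mapP.
  exists i; first by rewrite mem_iota i_gt0 add1n prednK.
  by apply/mapP; exists j; rewrite ?cij // mem_iota j_gt0 add1n prednK.
have [n2 m0 d0] := quasitriangular_has_id n_le3 eP R_qt c_neq0.
move: n2 eP RE c_neq0 m0 d0 {n_le n_le3 n_gt0} => -> eP RE c_neq0.
(* For n = 2 each code is one bit: the coefficient of e_1 in e_1 e_1, and that of e_1 \ox e_1 in the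
   coproduct of e_1. *)
move=> [] /negbFE/eqP m0 [] /negbFE/eqP d0.
have [_ expand ke e0 k0] := eP.
move: c_neq0; rewrite /code2 /= orbF => c_neq0.
exists (e 1%N), (k 1%N); split.
- split.
  + move=> e1; have := ke 1%N 1%N isT isT; rewrite e1 linear0 => /esym/eqP.
    by rewrite oner_eq0.
  + rewrite [LHS]expand !big_ord_recl big_ord0 /= -!/(mulc e k _ _ _).
    by rewrite m0 (mulc0 eP) // !scale0r !addr0.
  + rewrite [LHS](tcoef_sum eP) !big_ord_recl !big_ord0 /=.
    rewrite -!/(comulc e k _ _ _).
    rewrite d0 !(comulc0l eP) // !(comulc0r eP) // e0.
    by rewrite !scale0r !scale1r !addr0 !add0r addrC.
  + move=> h; exists (k 0 h), (k 1%N h).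
    by rewrite {1}[h]expand !big_ord_recl big_ord0 /= addr0 e0.
- by rewrite -k0 ke.
- by rewrite -e0 ke.
- by rewrite ke.
(* The one remaining coefficient of R is nonzero, hence 1 in F_2. *)
rewrite {1}RE !big_nat1 [tcoef _ _ _ _]F2_bool c_neq0 scale1r //.
Qed.

(** The counit removes the constant term, and 1 is the only nonzero scalar of F_2. *)
Lemma grassmann_generator_unique (x : grassmann) :
  grassmann_generator x -> counit x = 0 -> x = grassmann_x.
Proof.
case=> x_neq0 _ _ _ ex.
have [a [b xE]] : exists a b : 'F_2, x = a *: 1 + b *: grassmann_x.
  by exists (val x)`_0, (val x)`_1; apply: dual_coord.
have ex_gen : counit grassmann_x = 0 by apply: dual_counitX.
have a0 : a = 0.
  move: ex; rewrite xE linearP linearZ /= rmorph1 ex_gen scaler0 addr0.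
  by rewrite (_ : a *: (1 : ('F_2)^o) = a) //; apply: mulr1.
move: x_neq0; rewrite xE a0 scale0r add0r [b]F2_bool.
by case: (b != 0); rewrite ?mulr1n ?mulr0n ?scale1r ?scale0r => // /(_ erefl).
Qed.

Theorem proposition6p1 :
  (forall H : hopfType 'F_2, (\dim {:H} <= 3)%N ->
     (exists R : tensor H H, quasitriangular R /\ R <> 1 \ox 1)
       <-> hopf_iso H grassmann)
  /\ (forall R : tensor grassmann grassmann,
        (quasitriangular R /\ R <> 1 \ox 1)
          <-> R = 1 \ox 1 + grassmann_x \ox grassmann_x)
  /\ triangular (1 \ox 1 + grassmann_x \ox grassmann_x).
Proof.
have char2 : 2 \in [pchar 'F_2] := pchar_Fp (isT : prime 2).
split; last split.
- move=> H dimH; split=> [[R [R_qt R_neq1]]|/hopf_iso_generator[x xP]].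
    have [x [c [xP ex c1 cx _]]] := quasitriangular_generator dimH R_qt R_neq1.
    exact: generator_hopf_iso xP ex c1 cx.
  exists (1 \ox 1 + x \ox x); split.
    exact: grassmann_generator_quasitriangular.
  exact: grassmann_generator_nontrivial.
- move=> R; split=> [[R_qt R_neq1]|->].
    have dimG : (\dim {:grassmann} <= 3)%N by rewrite dim_dual_numbers.
    (* R is 1 \ox 1 + x \ox x for some generator x of counit 0, which uniqueness identifies with
       [grassmann_x]. *)
    have [x [_ [xP ex _ _ ->]]] := quasitriangular_generator dimG R_qt R_neq1.
    by rewrite (grassmann_generator_unique xP ex).
  split; first exact: grassmann_generator_quasitriangular char2 grassmann_xP.
  exact: grassmann_generator_nontrivial grassmann_xP.
exact: grassmann_generator_triangular char2 grassmann_xP.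
Qed.
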